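(* Let $A\in\mathbb{R}^{m\times n}$, $y\in\mathbb{R}^m$, let $k\ge 1$ be an integer and let $q$ be an integer with $2k\le q\le n$. Let $x^*\in\mathbb{R}^n$ be a (global) solution of $$\min_{x\in\mathbb{R}^n}\left\{\tfrac12\|y-Ax\|_2^2 : \|x\|_0\le k\right\},$$ and let $\eta:=y-Ax^*$. Suppose the restricted isometry constant of $A$ satisfies $\delta_{3k}<\alpha^*$, where $\alpha^*$ is the unique real root in $(0,1)$ of the equation $$\left(\left\lceil \tfrac{q}{k}\right\rceil+1\right)^2\alpha^3+\left(\left\lceil \tfrac{q}{k}\right\rceil+1\right)^2\alpha^2+\frac{2}{3+\sqrt5}\,\alpha-\frac{2}{3+\sqrt5}=0 .$$ Then the sequence $\{x^p\}_{p\ge 0}$ generated by the PGOT algorithm satisfies, for all $p\ge 0$, $$\|x^{p+1}-x^*\|_2\le \rho^p\|x^0-x^*\|_2+\frac{\tau}{1-\rho}\|\eta\|_2,$$ where $$\rho:=\frac{\sqrt5+1}{2}\left(\left\lceil \tfrac{q}{k}\right\rceil+1\right)\delta_{3k}\sqrt{\frac{1+\delta_k}{1-\delta_{2k}}}<1$$ (the inequality $\rho<1$ being guaranteed by the condition $\delta_{3k}<\alpha^*$) and $$\tau:=\frac{(\sqrt5+1)\left(\left\lceil \frac{q}{k}\right\rceil+1\right)(1+\delta_{2k})+4}{2\sqrt{1-\delta_{2k}}}.$$ In particular, if $\eta=0$, the sequence $\{x^p\}$ generated by PGOT converges to $x^*$.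
   Context: $\|x\|_0$ is the number of nonzero entries of $x$; $x$ is $s$-sparse if $\|x\|_0\le s$. $\lceil\cdot\rceil$ is the ceiling function, $\mathbf{e}\in\mathbb{R}^n$ is the vector of ones, and $\otimes$ is the entrywise (Hadamard) product of vectors. Restricted isometry constant: for an integer $s>0$, $\delta_s$ is the smallest number $\delta_s\ge 0$ such that $(1-\delta_s)\|x\|_2^2\le\|Ax\|_2^2\le(1+\delta_s)\|x\|_2^2$ for all $s$-sparse $x\in\mathbb{R}^n$. Hard thresholding: $\mathcal{H}_q(z)$ retains the $q$ entries of $z$ of largest magnitude and sets all other entries to zero (ties broken arbitrarily). PGOT algorithm (partial gradient optimal $k$-thresholding), with inputs $A,y,k,q$: start from $x^0=0$ and for $p=0,1,2,\dots$ set $u^p=x^p+\mathcal{H}_q\left(A^T(y-Ax^p)\right)$; $w^p\in\arg\min_w\{\|y-A(w\otimes u^p)\|_2^2:\ \mathbf{e}^Tw=k,\ w\in\{0,1\}^n\}$ (any minimizer); $x^{p+1}=w^p\otimes u^p$. *)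

(* Defs.v *)
From HB Require Import structures.
From mathcomp Require Import all_boot all_order all_algebra.
From mathcomp Require Import all_classical all_reals all_analysis.
Set Implicit Arguments.
Unset Strict Implicit.
Unset Printing Implicit Defensive.
Import Order.TTheory GRing.Theory Num.Theory.
Import numFieldNormedType.Exports.
Local Open Scope classical_set_scope.
Local Open Scope ring_scope.

(* The norm [`|x|] that the library puts on matrices is the sup norm. *)
Definition l2norm (R : realType) (n : nat) (x : 'cV[R]_n) : R :=
  Num.sqrt (\sum_(i < n) x i 0 ^+ 2).

Definition l0norm (R : realType) (n : nat) (x : 'cV[R]_n) : nat :=
  #|[pred i : 'I_n | x i 0 != 0]|.

Definition sparse (R : realType) (n s : nat) (x : 'cV[R]_n) : Prop :=
  (l0norm x <= s)%N.

Definition hadamard (R : realType) (n : nat) (w u : 'cV[R]_n) : 'cV[R]_n :=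
  map2_mx *%R w u.

Definition rip (R : realType) (m n : nat) (A : 'M[R]_(m, n)) (s : nat) (d : R)
    : Prop :=
  forall x : 'cV[R]_n, sparse s x ->
    (1 - d) * l2norm x ^+ 2 <= l2norm (A *m x) ^+ 2
    /\ l2norm (A *m x) ^+ 2 <= (1 + d) * l2norm x ^+ 2.

(* This infimum is attained, so it is the smallest element of the set: see
   [ric_smallest]. *)
Definition ric (R : realType) (m n : nat) (A : 'M[R]_(m, n)) (s : nat) : R :=
  inf [set d : R | 0 <= d /\ rip A s d].

Lemma l2norm_sqr (R : realType) (n : nat) (x : 'cV[R]_n) :
  l2norm x ^+ 2 = \sum_(i < n) x i 0 ^+ 2.
Proof. by rewrite sqr_sqrtr // sumr_ge0 // => i _; rewrite sqr_ge0. Qed.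

Lemma rip_nonempty (R : realType) (m n : nat) (A : 'M[R]_(m, n)) (s : nat) :
  exists d : R, 0 <= d /\ rip A s d.
Proof.
pose C : R := \sum_(i < m) (\sum_(j < n) `|A i j|) ^+ 2.
have C0 : 0 <= C by apply: sumr_ge0 => i _; rewrite sqr_ge0.
exists (1 + C); split; first by rewrite addr_ge0.
move=> x _; split.
  by apply: le_trans (sqr_ge0 _); rewrite opprD addNKr mulNr oppr_le0 mulr_ge0 ?sqr_ge0.
have N0 : 0 <= l2norm x by rewrite sqrtr_ge0.
have xle j : `|x j 0| <= l2norm x.
  rewrite -sqrtr_sqr ler_wsqrtr // (bigD1 j) //= lerDl.
  by apply: sumr_ge0 => i _; rewrite sqr_ge0.
apply: (@le_trans _ _ (C * l2norm x ^+ 2)); last first.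
  by rewrite ler_wpM2r ?sqr_ge0 // addrA lerDr.
rewrite l2norm_sqr mulr_suml; apply: ler_sum => i _.
rewrite -exprMn -real_normK ?num_real // ler_sqr ?nnegrE //; last first.
  by rewrite mulr_ge0 // sumr_ge0.
rewrite mxE mulr_suml; apply: le_trans (ler_norm_sum _ _ _) _.
by apply: ler_sum => j _; rewrite normrM ler_wpM2l.
Qed.

Lemma ric_smallest (R : realType) (m n : nat) (A : 'M[R]_(m, n)) (s : nat) :
  [/\ 0 <= ric A s, rip A s (ric A s)
    & forall d : R, 0 <= d -> rip A s d -> ric A s <= d].
Proof.
have ne : [set d : R | 0 <= d /\ rip A s d] !=set0 by exact: rip_nonempty.
split.
- by apply: lb_le_inf => // d [].
- move=> x sx; have [x0|x0] := eqVneq (l2norm x ^+ 2) 0.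
    have [d [_ /(_ x sx)]] := rip_nonempty A s.
    by rewrite x0 !mulr0.
  have xp : 0 < l2norm x ^+ 2 by rewrite lt_def x0 sqr_ge0.
  split.
    rewrite -ler_pdivlMr // lerBlDr addrC -lerBlDr; apply: lb_le_inf => // d [_ /(_ x sx)[h _]].
    by rewrite lerBlDr addrC -lerBlDr ler_pdivlMr.
  rewrite -ler_pdivrMr // -lerBlDl; apply: lb_le_inf => // d [_ /(_ x sx)[_ h]].
  by rewrite lerBlDl ler_pdivrMr.
- move=> d d0 dr; apply: ge_inf => //; by exists 0 => e [].
Qed.

Definition sparse_ls_solution (R : realType) (m n : nat) (A : 'M[R]_(m, n))
    (y : 'cV[R]_m) (k : nat) (xs : 'cV[R]_n) : Prop :=
  sparse k xs /\
  forall x : 'cV[R]_n, sparse k x ->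
    2^-1 * l2norm (y - A *m xs) ^+ 2 <= 2^-1 * l2norm (y - A *m x) ^+ 2.

(* [v] is one of the possible values of H_q(z); ties are broken by the choice
   of the retained index set [S]. *)
Definition hard_threshold (R : realType) (n q : nat) (z v : 'cV[R]_n) : Prop :=
  exists S : {set 'I_n},
    [/\ #|S| = q,
        forall i j : 'I_n, i \in S -> j \notin S -> `|z j 0| <= `|z i 0|
      & v = \col_i (if i \in S then z i 0 else 0)].

Definition binary_selection (R : realType) (n k : nat) (w : 'cV[R]_n) : Prop :=
  (forall i : 'I_n, w i 0 = 0 \/ w i 0 = 1) /\ \sum_(i < n) w i 0 = k%:R.

Definition optimal_selection (R : realType) (m n : nat) (A : 'M[R]_(m, n))
    (y : 'cV[R]_m) (k : nat) (u w : 'cV[R]_n) : Prop :=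
  binary_selection k w /\
  forall w' : 'cV[R]_n, binary_selection k w' ->
    l2norm (y - A *m hadamard w u) ^+ 2 <= l2norm (y - A *m hadamard w' u) ^+ 2.

Definition pgot_step (R : realType) (m n : nat) (A : 'M[R]_(m, n))
    (y : 'cV[R]_m) (k q : nat) (x x' : 'cV[R]_n) : Prop :=
  exists v w : 'cV[R]_n,
    [/\ hard_threshold q (A^T *m (y - A *m x)) v,
        optimal_selection A y k (x + v) w
      & x' = hadamard w (x + v)].

Definition pgot_sequence (R : realType) (m n : nat) (A : 'M[R]_(m, n))
    (y : 'cV[R]_m) (k q : nat) (x : nat -> 'cV[R]_n) : Prop :=
  x 0%N = 0 /\ forall p : nat, pgot_step A y k q (x p) (x p.+1).

Definition ceil_ratio (R : realType) (q k : nat) : R :=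
  (Num.ceil (q%:R / k%:R : R))%:~R.

Definition alpha_equation (R : realType) (q k : nat) (a : R) : Prop :=
  (ceil_ratio R q k + 1) ^+ 2 * a ^+ 3 + (ceil_ratio R q k + 1) ^+ 2 * a ^+ 2
    + 2 / (3 + Num.sqrt 5) * a - 2 / (3 + Num.sqrt 5) = 0.

Definition pgot_rho (R : realType) (m n : nat) (A : 'M[R]_(m, n)) (k q : nat)
    : R :=
  (Num.sqrt 5 + 1) / 2 * (ceil_ratio R q k + 1) * ric A (3 * k)
    * Num.sqrt ((1 + ric A k) / (1 - ric A (2 * k))).

Definition pgot_tau (R : realType) (m n : nat) (A : 'M[R]_(m, n)) (k q : nat)
    : R :=
  ((Num.sqrt 5 + 1) * (ceil_ratio R q k + 1) * (1 + ric A (2 * k)) + 4)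
    / (2 * Num.sqrt (1 - ric A (2 * k))).

(* Main.v *)
Require Import Defs.
From HB Require Import structures.
From mathcomp Require Import all_boot all_order all_algebra.
From mathcomp Require Import all_classical all_reals all_analysis.
From mathcomp Require Import ring lra.
Set Implicit Arguments.
Unset Strict Implicit.
Unset Printing Implicit Defensive.
Import Order.TTheory GRing.Theory Num.Theory.
Import numFieldNormedType.Exports.
Local Open Scope classical_set_scope.
Local Open Scope ring_scope.

(* Put [z := xs - x^p] and [r := A^T (A z + eta)], let [v] be the thresholding
   of [r] to an index set [Q] of size [q], and let [T] be a set of size [k]
   containing the support of [xs].  Optimality of the selection against the
   indicator of [T], with the restricted isometry property on both sides,
   bounds [x^(p+1) - xs] by the part of [v - z] on [T].  On any set of at most
   [k] indices [r - z] has norm at most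
     [D := delta_3k ||z|| + sqrt (1 + delta_k) ||eta||].
   On [T] inside [Q], [v - z] equals [r - z]; on [T] outside [Q] it equals
   [- z], and there [|z| <= |r - z| + |r|], where the entries of [r] are
   dominated by as many entries of [r] in [Q] off the support of [z], at which
   [r = r - z] (such indices exist because [q >= 2k]).  Hence the restriction
   of [v - z] to [T] has norm at most [3 D], and
     [3 <= (sqrt 5 + 1) / 2 * (ceil (q / k) + 1)]. *)

(** * Inner product, supports and coordinate restrictions *)

Definition dot (R : realType) (n : nat) (x y : 'cV[R]_n) : R :=
  \sum_(i < n) x i 0 * y i 0.

Definition supp (R : realType) (n : nat) (x : 'cV[R]_n) : {set 'I_n} :=
  [set i | x i 0 != 0].

Definition restr (R : realType) (n : nat) (S : {set 'I_n}) (x : 'cV[R]_n)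
    : 'cV[R]_n :=
  \col_i (if i \in S then x i 0 else 0).

Section Euclidean.
Variables (R : realType) (n : nat).
Implicit Types x y z : 'cV[R]_n.

Lemma dotC x y : dot x y = dot y x.
Proof. by apply: eq_bigr => i _; rewrite mulrC. Qed.

Lemma dotDl x y z : dot (x + y) z = dot x z + dot y z.
Proof. by rewrite -big_split; apply: eq_bigr => i _; rewrite mxE mulrDl. Qed.

Lemma dotZl (a : R) x y : dot (a *: x) y = a * dot x y.
Proof. by rewrite mulr_sumr; apply: eq_bigr => i _; rewrite mxE mulrA. Qed.

Lemma dotNl x y : dot (- x) y = - dot x y.
Proof. by rewrite -scaleN1r dotZl mulN1r. Qed.

Lemma dotDr x y z : dot z (x + y) = dot z x + dot z y.
Proof. by rewrite dotC dotDl !(dotC z). Qed.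

Lemma dotZr (a : R) x y : dot x (a *: y) = a * dot x y.
Proof. by rewrite dotC dotZl dotC. Qed.

Lemma dotNr x y : dot x (- y) = - dot x y.
Proof. by rewrite dotC dotNl dotC. Qed.

Definition dotE := (dotDl, dotDr, dotNl, dotNr, dotZl, dotZr).

Lemma l2norm_dot x : l2norm x ^+ 2 = dot x x.
Proof. by rewrite l2norm_sqr; apply: eq_bigr => i _; rewrite expr2. Qed.

Lemma l2norm_ge0 x : 0 <= l2norm x.
Proof. exact: sqrtr_ge0. Qed.

Lemma l2normN x : l2norm (- x) = l2norm x.
Proof. by congr Num.sqrt; apply: eq_bigr => i _; rewrite mxE sqrrN. Qed.

Lemma dot_ge0 x : 0 <= dot x x.
Proof. by rewrite -l2norm_dot sqr_ge0. Qed.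

Lemma norm_entry_le_l2norm x i : `|x i 0| <= l2norm x.
Proof.
rewrite -sqrtr_sqr ler_wsqrtr // (bigD1 i) //= lerDl.
by apply: sumr_ge0 => j _; rewrite sqr_ge0.
Qed.

(** Convergence of column vectors is measured in the sup norm; this carries Euclidean bounds over to
    it. *)
Lemma mx_norm_le_l2norm x : `|x| <= l2norm x.
Proof.
rewrite /Num.norm /= mx_normrE; apply: bigmax_le; first exact: l2norm_ge0.
by move=> [i j] _ /=; rewrite ord1 norm_entry_le_l2norm.
Qed.

Lemma l2norm_eq0 x : l2norm x = 0 -> x = 0.
Proof.
move=> x0; apply/matrixP => i j; rewrite ord1 mxE; apply/eqP.
by rewrite -normr_le0 -x0 norm_entry_le_l2norm.
Qed.

Lemma l2norm0 : l2norm (0 : 'cV[R]_n) = 0.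
Proof. by rewrite /l2norm big1 ?sqrtr0 // => i _; rewrite mxE expr0n. Qed.

(** Cauchy-Schwarz, from expanding the nonnegative squared norm of
    [l2norm y *: x - l2norm x *: y]. *)
Lemma dot_le x y : dot x y <= l2norm x * l2norm y.
Proof.
have [/l2norm_eq0 ->|x0] := eqVneq (l2norm x) 0.
  by rewrite l2norm0 mul0r /dot big1 // => i _; rewrite mxE mul0r.
have [/l2norm_eq0 ->|y0] := eqVneq (l2norm y) 0.
  by rewrite l2norm0 mulr0 /dot big1 // => i _; rewrite mxE mulr0.
have xy0 : 0 < l2norm x * l2norm y by rewrite mulr_gt0 // lt_def ?x0 ?y0 l2norm_ge0.
have := dot_ge0 (l2norm y *: x - l2norm x *: y).
have -> : dot (l2norm y *: x - l2norm x *: y) (l2norm y *: x - l2norm x *: y)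
  = 2 * (l2norm x * l2norm y) * (l2norm x * l2norm y - dot x y).
  by rewrite !dotE -!l2norm_dot (dotC y x); ring.
by rewrite pmulr_rge0 ?subr_ge0 //; exact: mulr_gt0.
Qed.

Lemma ler_l2normD x y : l2norm (x + y) <= l2norm x + l2norm y.
Proof.
rewrite -ler_sqr ?nnegrE ?addr_ge0 ?l2norm_ge0 //.
rewrite l2norm_dot !dotE -!l2norm_dot (dotC y x).
by have := dot_le x y; nra.
Qed.

Lemma ler_l2normB x y : l2norm (x - y) <= l2norm x + l2norm y.
Proof. by rewrite -(l2normN y) ler_l2normD. Qed.

Lemma l0normE x : l0norm x = #|supp x|.
Proof. by rewrite /supp cardsE. Qed.

Lemma sparse_subset (S : {set 'I_n}) s x :
  (#|S| <= s)%N -> (forall i, i \notin S -> x i 0 = 0) -> sparse s x.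
Proof.
move=> Ss xS; rewrite /sparse l0normE (leq_trans _ Ss) // subset_leq_card //.
by apply/fintype.subsetP => i; rewrite inE; apply: contraR => /xS ->.
Qed.

Lemma dot_restr (S : {set 'I_n}) x : dot (restr S x) x = l2norm (restr S x) ^+ 2.
Proof.
rewrite l2norm_sqr; apply: eq_bigr => i _; rewrite mxE.
by case: ifP => _; rewrite ?expr2 // !mul0r.
Qed.

Lemma l2norm_restr_sqr (S : {set 'I_n}) x :
  l2norm (restr S x) ^+ 2 = \sum_(i in S) x i 0 ^+ 2.
Proof.
rewrite l2norm_sqr [RHS]big_mkcond; apply: eq_bigr => i _ /=; rewrite mxE.
by case: ifP => // _; rewrite expr0n.
Qed.

Lemma restrD (S : {set 'I_n}) x y : restr S (x + y) = restr S x + restr S y.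
Proof. by apply/matrixP => i j; rewrite !mxE; case: ifP; rewrite // addr0. Qed.

End Euclidean.

Lemma dot_mulmx (R : realType) (m n : nat) (A : 'M[R]_(m, n)) x y :
  dot (A *m x) y = dot x (A^T *m y).
Proof.
have dotM p (a b : 'cV[R]_p) : dot a b = (a^T *m b) 0 0.
  by rewrite mxE; apply: eq_bigr => i _; rewrite mxE.
by rewrite !dotM trmx_mul mulmxA.
Qed.

(** * Comparison of sums, and sets of prescribed cardinality *)

Section SetSums.
Variables (R : realType) (T : finType).

(** Both sums are compared with copies of [M], the maximum of [f] on [B]. *)
Lemma ler_sum_dominated (f : T -> R) (B U : {set T}) :
  (#|B| <= #|U|)%N -> (forall i, 0 <= f i) ->
  (forall i j, i \in U -> j \in B -> f j <= f i) ->
  \sum_(j in B) f j <= \sum_(i in U) f i.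
Proof.
move=> BU f0 fBU.
have [->|[j0 j0B]] := set_0Vmem B; first by rewrite big_set0 sumr_ge0.
pose M := \big[Num.max/0]_(j in B) f j.
have fM j : j \in B -> f j <= M by move=> jB; apply: (le_bigmax_cond _ f jB).
have MU i : i \in U -> M <= f i.
  by move=> iU; apply: bigmax_le => // j jB; exact: fBU.
apply: (@le_trans _ _ (\sum_(j in B) M)); first exact: ler_sum.
apply: (@le_trans _ _ (\sum_(i in U) M)); last exact: ler_sum.
rewrite !sumr_const ler_wpMn2l //; exact: le_trans (f0 j0) (fM _ j0B).
Qed.

Lemma subset_of_card (B : {set T}) (k : nat) :
  (k <= #|B|)%N -> exists U : {set T}, U \subset B /\ #|U| = k.
Proof.
rewrite -bin_gt0 -cards_draws card_gt0 => /set0Pn[U].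
by rewrite inE => /andP[UB /eqP Uk]; exists U.
Qed.

Lemma superset_of_card (B : {set T}) (k : nat) :
  (#|B| <= k <= #|T|)%N -> exists U : {set T}, B \subset U /\ #|U| = k.
Proof.
move=> /andP[Bk kT].
have [|U [UB Uk]] := @subset_of_card (~: B) (#|T| - k).
  by rewrite cardsCs finset.setCK leq_sub2l.
exists (~: U); split; first by rewrite -(finset.setCK B) finset.setCS.
by rewrite cardsCs finset.setCK Uk subKn.
Qed.

End SetSums.

(** * Consequences of the restricted isometry property *)

Section RestrictedIsometry.
Variables (R : realType) (m n : nat) (A : 'M[R]_(m, n)).

Lemma ric_mono (s t : nat) : (s <= t)%N -> ric A s <= ric A t.
Proof.
move=> st; have [_ _ hs] := ric_smallest A s; have [t0 ht _] := ric_smallest A t.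
by apply: hs => // x xs; apply: ht; exact: leq_trans xs st.
Qed.

(** Subtract the lower bound at [h - z] from the upper bound at [h + z]: the cross terms add up, and
    the squares combine by the parallelogram law. *)
Lemma rip_polar (s : nat) (d : R) (h z : 'cV[R]_n) :
  rip A s d -> sparse s (h + z) -> sparse s (h - z) ->
  2 * (dot (A *m h) (A *m z) - dot h z) <= d * (dot h h + dot z z).
Proof.
move=> ripA /ripA[_ hp] /ripA[hm _].
move: hp hm; rewrite !l2norm_dot mulmxDr mulmxBr !dotE.
rewrite (dotC (A *m z) (A *m h)) (dotC z h).
by move: (dot _ _) (dot (A *m h) (A *m h)) (dot h z) (dot h h) => a b c e; lra.
Qed.

(** The restriction [h] of [A^T A z - z] is its own test vector: its squared norm is
    [dot (A *m h) (A *m z) - dot h z], which polarisation bounds because [h] and [z] both live on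
    [V :|: supp z]. *)
Lemma restr_gram_le (s : nat) (d : R) (z : 'cV[R]_n) (V : {set 'I_n}) :
  0 <= d -> rip A s d -> (#|V :|: supp z| <= s)%N ->
  l2norm (restr V (A^T *m (A *m z) - z)) <= d * l2norm z.
Proof.
move=> d0 ripA Vs; set h := restr V _; set H := l2norm h.
have suppP i : i \notin V :|: supp z -> h i 0 = 0 /\ z i 0 = 0.
  by rewrite !inE negb_or negbK mxE => /andP[/negbTE -> /eqP].
have hH : dot (A *m h) (A *m z) - dot h z = H ^+ 2.
  by rewrite dot_mulmx -dotNr -dotDr dot_restr.
(* Polarising at [t h] and [z]; the choice [t = 1/d] is optimal. *)
have key (t : R) : 2 * t * H ^+ 2 <= d * (t ^+ 2 * H ^+ 2 + l2norm z ^+ 2).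
  have sp (e : 'cV[R]_n) (a : R) : e = t *: h + a *: z -> sparse s e.
    move=> ->; apply: sparse_subset Vs _ => i /suppP[h0 z0].
    by rewrite mxE [X in X + _]mxE [X in _ + X]mxE h0 z0 !mulr0 addr0.
  have := @rip_polar s d (t *: h) z ripA (sp _ 1 _) (sp _ (- 1) _).
  rewrite scale1r scaleN1r => /(_ erefl erefl).
  rewrite -scalemxAr !dotE -!l2norm_dot -/H -mulrBr hH.
  by rewrite !mulrA expr2.
rewrite -ler_sqr ?nnegrE ?mulr_ge0 ?l2norm_ge0 // exprMn.
have [d0'|dn0] := eqVneq d 0.
  by have := key 1; rewrite d0'; lra.
(* The two sides become those of [key d^-1], multiplied by [d] and diminished by [H ^+ 2]. *)
have -> : H ^+ 2 = 2 * d^-1 * H ^+ 2 * d - H ^+ 2 by field.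
have -> : d ^+ 2 * l2norm z ^+ 2
    = d * (d^-1 ^+ 2 * H ^+ 2 + l2norm z ^+ 2) * d - H ^+ 2 by field.
by rewrite lerD2r ler_wpM2r.
Qed.

(** Duality: the restriction [h] of [A^T e] satisfies [dot (A *m h) e = l2norm h ^+ 2].
    Cauchy-Schwarz and the upper isometry bound at [h] leave one factor [l2norm h] to cancel. *)
Lemma restr_trmx_le (s : nat) (d : R) (e : 'cV[R]_m) (V : {set 'I_n}) :
  0 <= d -> rip A s d -> (#|V| <= s)%N ->
  l2norm (restr V (A^T *m e)) <= Num.sqrt (1 + d) * l2norm e.
Proof.
move=> d0 ripA Vs; set h := restr V _; set H := l2norm h.
have d1 : 0 < 1 + d by rewrite ltr_pwDl.
have sh : sparse s h.
  by apply: sparse_subset Vs _ => i /negbTE iV; rewrite mxE iV.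
have [_ hA] := ripA _ sh.
have hH : dot (A *m h) e = H ^+ 2 by rewrite dot_mulmx dot_restr.
have := dot_le (A *m h) e; rewrite hH => hle.
have Ah : l2norm (A *m h) <= Num.sqrt (1 + d) * H.
  rewrite -ler_sqr ?nnegrE ?mulr_ge0 ?sqrtr_ge0 ?l2norm_ge0 //.
  by rewrite exprMn (sqr_sqrtr (ltW d1)).
have [H0|Hn0] := eqVneq H 0; first by rewrite H0 mulr_ge0 ?sqrtr_ge0 ?l2norm_ge0.
have Hp : 0 < H by rewrite lt_def Hn0 l2norm_ge0.
rewrite -(ler_pM2r Hp) -expr2; apply: le_trans hle _.
by rewrite mulrAC ler_wpM2r ?l2norm_ge0.
Qed.

End RestrictedIsometry.

(** * One iteration: thresholding, then optimal selection *)

Section PartialGradientStep.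
Variables (R : realType) (m n k q : nat) (A : 'M[R]_(m, n)).
Hypothesis kq : (2 * k <= q)%N.

(** The factor 3 counts pieces of norm at most [D]: [r - z] on [T :&: Q], on [P1], and on the set
    [U] that replaces [P1] in the estimate of [r]. *)
Lemma threshold_error (z v : 'cV[R]_n) (e : 'cV[R]_m) (T : {set 'I_n}) :
  sparse (2 * k) z -> #|T| = k ->
  hard_threshold q (A^T *m (A *m z + e)) v ->
  l2norm (restr T (v - z))
    <= 3 * (ric A (3 * k) * l2norm z + Num.sqrt (1 + ric A k) * l2norm e).
Proof.
move=> sz Tk [Q [Qq Qmax ->]]; set r := A^T *m _ in Qmax *.
set D := _ + _ * l2norm e.
have Dbound (V : {set 'I_n}) : (#|V| <= k)%N -> l2norm (restr V (r - z)) <= D.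
  move=> Vk; rewrite /r mulmxDr addrAC restrD.
  apply: le_trans (ler_l2normD _ _) _; rewrite lerD //.
    (* The support of [z] has at most [2k] indices and [V] at most [k], whence the order [3k]. *)
    have [d0 dr _] := ric_smallest A (3 * k).
    apply: restr_gram_le d0 dr _; rewrite (leq_trans (leq_card_setU _ _)) //.
    by rewrite -l0normE (mulnDl 1 2) mul1n leq_add.
  by have [d0 dr _] := ric_smallest A k; exact: restr_trmx_le d0 dr Vk.
clearbody r.
(* Outside [Q] the thresholded vector vanishes, so on [T] minus [Q] the error is nonzero only where
   [z] is. *)
pose P1 := (T :&: supp z) :\: Q.
have P1k : (#|P1| <= k)%N.
  by rewrite -Tk subset_leq_card // (fintype.subset_trans (finset.subsetDl _ _)) ?finset.subsetIl.
have [U [UQ UP1]] : exists U : {set 'I_n}, U \subset Q :\: supp z /\ #|U| = #|P1|.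
  (* Since [supp z] has at most [2k <= q = #|Q|] indices, removing the common part leaves at least
     as many in [Q :\: supp z] as in [supp z :\: Q], which contains [P1]. *)
  apply: subset_of_card; apply: (@leq_trans #|supp z :\: Q|).
    by rewrite subset_leq_card // finset.setSD // finset.subsetIr.
  rewrite !cardsD finset.setIC leq_sub2r // Qq -l0normE.
  exact: leq_trans sz kq.
have rP1 : l2norm (restr P1 r) <= l2norm (restr U r).
  rewrite -ler_sqr ?nnegrE ?l2norm_ge0 // !l2norm_restr_sqr.
  apply: ler_sum_dominated => [|i|i j iU jP1]; first by rewrite UP1.
    exact: sqr_ge0.
  rewrite -(real_normK (num_real (r j 0))) -(real_normK (num_real (r i 0))) ler_sqr ?nnegrE //.
  move/fintype.subsetP: UQ => /(_ _ iU); rewrite inE => /andP[_ iQ].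
  by apply: Qmax => //; move: jP1; rewrite inE => /andP[].
have rU : restr U r = restr U (r - z).
  apply/matrixP => i j; rewrite !mxE; case: ifP => // iU.
  move/fintype.subsetP: UQ => /(_ _ iU); rewrite !inE negbK => /andP[/eqP -> _].
  by rewrite subr0.
set v' := \col_i _.
(* On [P1] the last two terms combine to [- z]; at the indices of [T] outside both [Q] and [P1], [z]
   is zero. *)
have -> : restr T (v' - z) = restr (T :&: Q) (r - z) + (restr P1 (r - z) - restr P1 r).
  apply/matrixP => i j; rewrite /v' /P1 ord1 {Qmax D Dbound P1 P1k U UQ UP1 rP1 rU v'}.
  rewrite !mxE !inE.
  by case: (i \in T); case: (i \in Q); have [->|_] := eqVneq (z i 0) 0 => /=; ring.
apply: le_trans (ler_l2normD _ _) _.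
have := ler_l2normB (restr P1 (r - z)) (restr P1 r).
have := Dbound P1 P1k.
have : l2norm (restr U r) <= D by rewrite rU Dbound ?UP1.
have : l2norm (restr (T :&: Q) (r - z)) <= D.
  by apply: Dbound; rewrite -Tk subset_leq_card // finset.subsetIl.
by lra.
Qed.

(** The competitor minus [xs] is supported in [T], so the upper isometry bound has order [k];
    [x' - xs] joins two supports, so the lower one has order [2k]. Sparsity of [x'] lets the
    estimate be iterated. *)
Lemma pgot_contraction (y : 'cV[R]_m) (xs x x' : 'cV[R]_n) :
  (k <= n)%N -> ric A (2 * k) < 1 ->
  sparse k xs -> sparse k x -> pgot_step A y k q x x' ->
  sparse k x' /\
  Num.sqrt (1 - ric A (2 * k)) * l2norm (x' - xs)
    <= 3 * Num.sqrt (1 + ric A k)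
         * (ric A (3 * k) * l2norm (x - xs) + Num.sqrt (1 + ric A k) * l2norm (y - A *m xs))
       + 2 * l2norm (y - A *m xs).
Proof.
move=> kn d1 sxs sx [v [w [vH [[w01 wk] wopt] ->]]].
set u := x + v in wopt *; set eta := y - A *m xs.
have sparse_hadamard (w' : 'cV[R]_n) : binary_selection k w' -> sparse k (hadamard w' u).
  move=> [w'01 w'k]; apply: (@sparse_subset _ _ (supp w')) => [|i]; last first.
    by rewrite inE negbK mxE => /eqP ->; rewrite mul0r.
  suff : #|supp w'|%:R = k%:R :> R by move/eqP; rewrite eqr_nat => /eqP ->.
  rewrite -w'k -sumr_const big_mkcond; apply: eq_bigr => i _ /=.
  by rewrite inE; have [->|->] := w'01 i; rewrite ?eqxx ?oner_eq0.
have sx' := sparse_hadamard w (conj w01 wk); split=> //.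
(* A binary selection has entry sum exactly [k], so the support of [xs] is padded to exactly [k]
   indices. *)
have [|T [ST Tk]] := @superset_of_card _ (supp xs) k.
  by rewrite -l0normE card_ord kn andbT.
pose wT : 'cV[R]_n := \col_i (i \in T)%:R.
have wTb : binary_selection k wT.
  split=> [i|]; first by rewrite mxE; case: (i \in T); [right|left].
  rewrite -Tk -sumr_const [RHS]big_mkcond; apply: eq_bigr => i _.
  by rewrite mxE; case: (i \in T).
have xsT i : i \notin T -> xs i 0 = 0.
  by move=> iT; apply/eqP; apply: contraR iT => xi; apply: (fintype.subsetP ST); rewrite inE.
have wTE : hadamard wT u - xs = restr T (v - (xs - x)).
  apply/matrixP => i j; rewrite ord1 !mxE; case: ifPn => [_|/xsT ->].
    by rewrite mul1r; ring.
  by rewrite mul0r subr0.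
set xn := hadamard w u in wopt sx' *.
have resid (a : 'cV[R]_n) : y - A *m a = eta - A *m (a - xs).
  by rewrite /eta mulmxBr opprB addrA subrK.
have sT : sparse k (hadamard wT u - xs).
  by rewrite wTE; apply: (@sparse_subset _ _ T); rewrite ?Tk // => i /negbTE iT; rewrite mxE iT.
have sxx (a b : 'cV[R]_n) : sparse k a -> sparse k b -> sparse (2 * k) (a - b).
  move=> sa sb; apply: (@sparse_subset _ _ (supp a :|: supp b)).
    rewrite (leq_trans (leq_card_setU _ _)) // -!l0normE mul2n -addnn.
    exact: leq_add.
  by move=> i; rewrite !inE negb_or !negbK !mxE => /andP[/eqP -> /eqP ->]; rewrite subr0.
have [_ r2 _] := ric_smallest A (2 * k).
have [dk0 rk _] := ric_smallest A k.
have lower : Num.sqrt (1 - ric A (2 * k)) * l2norm (xn - xs) <= l2norm (A *m (xn - xs)).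
  rewrite -ler_sqr ?nnegrE ?mulr_ge0 ?sqrtr_ge0 ?l2norm_ge0 //.
  rewrite exprMn (@sqr_sqrtr _ (1 - _)) ?subr_ge0 ?(ltW d1) //.
  by have [] := r2 _ (sxx _ _ sx' sxs).
have upper : l2norm (A *m (hadamard wT u - xs))
    <= Num.sqrt (1 + ric A k) * l2norm (hadamard wT u - xs).
  rewrite -ler_sqr ?nnegrE ?mulr_ge0 ?sqrtr_ge0 ?l2norm_ge0 //.
  rewrite exprMn (@sqr_sqrtr _ (1 + _)) ?addr_ge0 //.
  by have [] := rk _ sT.
have opt : l2norm (y - A *m xn) <= l2norm (y - A *m hadamard wT u).
  by rewrite -ler_sqr ?nnegrE ?l2norm_ge0 // wopt.
(* A triangle inequality on each side of [opt] costs one [l2norm eta]; together they give the term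
   [2 * l2norm eta]. *)
have := ler_l2normB eta (A *m (hadamard wT u - xs)).
have := ler_l2normB eta (eta - A *m (xn - xs)).
rewrite opprB addrC subrK -!resid => h1 h2.
have vH' : hard_threshold q (A^T *m (A *m (xs - x) + eta)) v.
  by rewrite /eta addrC mulmxBr addrA subrK.
have := threshold_error (sxx _ _ sxs sx) Tk vH'; rewrite -wTE -(l2normN (xs - x)) opprB => h3.
have := ler_wpM2l (sqrtr_ge0 (1 + ric A k)) h3.
rewrite mulrCA mulrA => h4.
by lra.
Qed.

End PartialGradientStep.

(** * The cubic equation and the constants of the rate *)

Section RateConstants.
Variable R : realType.

Lemma ge2_ceil_ratio (q k : nat) :
  (0 < k)%N -> (2 * k <= q)%N -> 2 <= ceil_ratio R q k.
Proof.
move=> k0 kq; apply: le_trans (Num.Theory.ceil_ge _).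
by rewrite ler_pdivlMr ?ltr0n // -natrM ler_nat.
Qed.

Lemma sqrt5_ge2 : 2 <= Num.sqrt 5 :> R.
Proof. by rewrite -ler_sqr ?nnegrE ?sqrtr_ge0 // sqr_sqrtr //; lra. Qed.

(** The golden ratio squared is [(3 + sqrt 5) / 2]; this ties the factor in [pgot_rho] to the
    coefficient in [alpha_equation]. *)
Lemma golden_sqr : ((Num.sqrt 5 + 1) / 2) ^+ 2 = ((2 / (3 + Num.sqrt 5))^-1 : R).
Proof.
have s5 : Num.sqrt 5 ^+ 2 = 5 :> R by rewrite sqr_sqrtr.
have := sqrt5_ge2; move: (Num.sqrt 5) s5 => s s5 s2.
have -> : ((s + 1) / 2) ^+ 2 = (s ^+ 2 + 2 * s + 1) / 4 by field.
rewrite s5; field; lra.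
Qed.

(** Strictness comes from the linear term; the higher powers are nondecreasing on nonnegative
    arguments. *)
Lemma alpha_poly_mono (C b : R) : 0 < b ->
  {in Num.nneg &, {homo (fun a : R => C ^+ 2 * a ^+ 3 + C ^+ 2 * a ^+ 2 + b * a - b)
    : a1 a2 / a1 < a2}}.
Proof.
move=> b0 a1 a2; rewrite !nnegrE => a10 a20 a12.
have a12' := ltW a12.
rewrite ltrD2r ler_ltD ?ltr_pM2l // lerD // ler_wpM2l ?sqr_ge0 //;
  by rewrite lerXn2r ?nnegrE.
Qed.

(** The cubic is [- b < 0] at 0 and [2 * C ^+ 2 > 0] at 1, so it has a root between them; strict
    monotonicity makes it unique. *)
Lemma alpha_unique (q k : nat) : (0 < k)%N -> (2 * k <= q)%N ->
  exists! a : R, 0 < a < 1 /\ alpha_equation q k a.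
Proof.
move=> k0 kq; have := ge2_ceil_ratio k0 kq; rewrite /alpha_equation.
set C := _ + 1; set b := 2 / _ => c2.
have b0 : 0 < b by rewrite divr_gt0 ?addr_gt0 // sqrtr_gt0.
have C0 : 0 < C ^+ 2 by rewrite exprn_gt0 // /C; lra.
pose p : {poly R} := (C ^+ 2) *: 'X^3 + (C ^+ 2) *: 'X^2 + b *: 'X - b%:P.
have pE a : p.[a] = C ^+ 2 * a ^+ 3 + C ^+ 2 * a ^+ 2 + b * a - b.
  by rewrite /p !hornerE.
have [|a /andP[a0 a1] /rootP] := @poly_ivt _ p 0 1 ler01.
  by rewrite !pE; apply/andP; split; lra.
rewrite pE => pa; exists a; split.
  split=> //; rewrite !lt_neqAle a0 a1 !andbT; apply/andP; split.
    by apply/eqP => az; move: pa; rewrite -az; lra.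
  by apply/eqP => az; move: pa; rewrite az; lra.
move=> a' [/andP[a'0 _] pa'].
have [aa|aa|//] := ltgtP a a'.
  by have := alpha_poly_mono C b0 a0 (ltW a'0) aa; rewrite pa pa' ltxx.
by have := alpha_poly_mono C b0 (ltW a'0) a0 aa; rewrite pa pa' ltxx.
Qed.

(** Induction works because [b / (1 - r)] is the fixed point of [t |-> r * t + b]. *)
Lemma affine_recurrence_bound (E : nat -> R) (r b : R) :
  0 <= r < 1 -> 0 <= b -> (forall p, E p.+1 <= r * E p + b) ->
  forall p, E p <= r ^+ p * E 0%N + b / (1 - r).
Proof.
move=> /andP[r0 r1] b0 Er; have r1' : 0 < 1 - r by rewrite subr_gt0.
elim=> [|p IH]; first by rewrite expr0 mul1r lerDl divr_ge0 // ltW.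
apply: le_trans (Er p) _.
have -> : r ^+ p.+1 * E 0%N + b / (1 - r) = r * (r ^+ p * E 0%N + b / (1 - r)) + b.
  by rewrite exprS; field; rewrite gt_eqF.
by rewrite lerD2r ler_wpM2l.
Qed.

Lemma pgot_rho_ge0 (m n k q : nat) (A : 'M[R]_(m, n)) :
  (0 < k)%N -> (2 * k <= q)%N -> 0 <= pgot_rho A k q.
Proof.
move=> k0 kq; have c2 := ge2_ceil_ratio k0 kq; have s2 := sqrt5_ge2.
have [d0 _ _] := ric_smallest A (3 * k).
by rewrite /pgot_rho !mulr_ge0 ?sqrtr_ge0 ?invr_ge0 // addr_ge0 // ltW //; lra.
Qed.

(** After squaring, the claim is [C ^+ 2 * d ^+ 2 * (1 + e) < b * (1 - f)], where [e] and [f], of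
    orders [k] and [2k], are at most [d < a]. The left side is at most [C ^+ 2 * a ^+ 2 * (1 + a)],
    which the equation turns into [(1 - a) * b]. *)
Lemma pgot_rho_lt1 (m n k q : nat) (A : 'M[R]_(m, n)) (a : R) :
  (0 < k)%N -> (2 * k <= q)%N ->
  0 < a < 1 -> alpha_equation q k a -> ric A (3 * k) < a ->
  pgot_rho A k q < 1.
Proof.
move=> k0 kq /andP[a0 a1]; rewrite /alpha_equation => eqa da.
have c2 := ge2_ceil_ratio k0 kq; have s2 := sqrt5_ge2.
have [d0 _ _] := ric_smallest A (3 * k).
have [dk0 _ _] := ric_smallest A k.
have dk : ric A k <= ric A (3 * k) by apply: ric_mono; rewrite leq_pmull.
have d2 : ric A (2 * k) <= ric A (3 * k) by apply: ric_mono; rewrite leq_mul2r orbT.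
rewrite -(@ltr_pXn2r _ 2) ?nnegrE ?pgot_rho_ge0 // expr1n /pgot_rho.
rewrite !exprMn -[_ * 2^-1 ^+ 2]exprMn golden_sqr sqr_sqrtr; last by rewrite divr_ge0; lra.
move: eqa; set C := _ + 1; set b := 2 / (3 + _) => eqa.
have b0 : 0 < b by rewrite divr_gt0 //; lra.
move: dk d2 dk0 d0 da; move: (ric A k) (ric A (2 * k)) (ric A (3 * k)) => e f d.
move=> ed fd e0 d0 da.
have bf0 : 0 < b * (1 - f) by rewrite mulr_gt0 //; lra.
have -> : b^-1 * C ^+ 2 * d ^+ 2 * ((1 + e) / (1 - f))
    = C ^+ 2 * (d ^+ 2 * (1 + e)) / (b * (1 - f)).
  by field; move: bf0; rewrite pmulr_rgt0 // => f1; rewrite !gt_eqF.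
rewrite ltr_pdivrMr // mul1r.
have le_a : C ^+ 2 * (d ^+ 2 * (1 + e)) <= C ^+ 2 * (a ^+ 2 * (1 + a)).
  rewrite ler_wpM2l ?sqr_ge0 // ler_pM ?sqr_ge0 //; try lra.
  by rewrite lerXn2r ?nnegrE //; lra.
apply: le_lt_trans le_a _.
have -> : C ^+ 2 * (a ^+ 2 * (1 + a)) = (1 - a) * b.
  by apply/eqP; rewrite -subr_eq0 -eqa; apply/eqP; ring.
by rewrite mulrC ltr_pM2l //; lra.
Qed.

(** Division by [sqrt (1 - delta_2k)] yields the stated constants once 3 is enlarged to
    [(sqrt 5 + 1) / 2 * (ceil (q / k) + 1)] and [1 + delta_k] to [1 + delta_2k]. *)
Lemma pgot_rate (m n k q : nat) (A : 'M[R]_(m, n)) (E E' N : R) :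
  (0 < k)%N -> (2 * k <= q)%N -> ric A (2 * k) < 1 -> 0 <= E -> 0 <= N ->
  Num.sqrt (1 - ric A (2 * k)) * E'
    <= 3 * Num.sqrt (1 + ric A k)
         * (ric A (3 * k) * E + Num.sqrt (1 + ric A k) * N) + 2 * N ->
  E' <= pgot_rho A k q * E + pgot_tau A k q * N.
Proof.
move=> k0 kq f1 E0 N0 step.
have c2 := ge2_ceil_ratio k0 kq; have s2 := sqrt5_ge2.
have [d0 _ _] := ric_smallest A (3 * k).
have [e0 _ _] := ric_smallest A k.
have ef : ric A k <= ric A (2 * k) by apply: ric_mono; rewrite leq_pmull.
rewrite /pgot_rho /pgot_tau.
rewrite sqrtrM ?sqrtrV; [|lra|lra].
have S0 : 0 < Num.sqrt (1 - ric A (2 * k)) by rewrite sqrtr_gt0 subr_gt0.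
have T2 : Num.sqrt (1 + ric A k) ^+ 2 = 1 + ric A k by rewrite sqr_sqrtr //; lra.
have T0 : 0 <= Num.sqrt (1 + ric A k) by exact: sqrtr_ge0.
move: S0 T2 T0 step; move: (Num.sqrt (1 - ric A (2 * k))) (Num.sqrt (1 + ric A k)) => S T S0 T2 T0 step.
rewrite -(ler_pM2l S0); apply: le_trans step _.
move: d0 e0 ef c2 T2; move: (ric A (3 * k)) (ric A k) (ric A (2 * k)) (ceil_ratio R q k) => d e f c d0 e0 ef c2 T2.
move: s2; move: (Num.sqrt 5) => s s2.
have g3 : 3 <= (s + 1) / 2 * (c + 1) by nra.
have -> : S * ((s + 1) / 2 * (c + 1) * d * (T / S) * E
    + ((s + 1) * (c + 1) * (1 + f) + 4) / (2 * S) * N)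
  = (s + 1) / 2 * (c + 1) * (T * d * E) + (s + 1) / 2 * (c + 1) * ((1 + f) * N) + 2 * N.
  by field; rewrite gt_eqF.
have -> : 3 * T * (d * E + T * N) + 2 * N = 3 * (T * d * E) + 3 * (T ^+ 2 * N) + 2 * N by ring.
rewrite T2 lerD2r lerD //; first by rewrite ler_wpM2r // !mulr_ge0.
rewrite ler_pM // ?mulr_ge0 ?addr_ge0 //.
by rewrite ler_wpM2r // lerD2l.
Qed.

End RateConstants.

(** * The error bound and convergence of the iterates *)

Theorem theorem1 (R : realType) (m n k q : nat)
    (A : 'M[R]_(m, n)) (y : 'cV[R]_m) (xs : 'cV[R]_n)
    (hk : (1 <= k)%N) (hkq : (2 * k <= q)%N) (hqn : (q <= n)%N)
    (hxs : sparse_ls_solution A y k xs) :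
  (exists! a : R, 0 < a < 1 /\ alpha_equation q k a) /\
  forall alpha : R, 0 < alpha < 1 -> alpha_equation q k alpha ->
  ric A (3 * k) < alpha ->
  let eta := y - A *m xs in
  let rho := pgot_rho A k q in
  let tau := pgot_tau A k q in
  rho < 1 /\
  forall x : nat -> 'cV[R]_n, pgot_sequence A y k q x ->
    (forall p : nat,
        l2norm (x p.+1 - xs)
          <= rho ^+ p * l2norm (x 0%N - xs) + tau / (1 - rho) * l2norm eta)
    /\ (eta = 0 -> x p @[p --> \oo] --> xs).
Proof.
split=> [|alpha alpha01 eq_alpha d_alpha eta rho tau]; first exact: alpha_unique.
have rho1 : rho < 1 := pgot_rho_lt1 hk hkq alpha01 eq_alpha d_alpha.
have rho0 : 0 <= rho := pgot_rho_ge0 A hk hkq.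
split=> // x [x0 xstep]; have [sxs _] := hxs.
have d2 : ric A (2 * k) < 1.
  have /andP[_ a1] := alpha01; apply: le_lt_trans (lt_trans d_alpha a1).
  by apply: ric_mono; rewrite leq_mul2r orbT.
have kn : (k <= n)%N by rewrite (leq_trans _ (leq_trans hkq hqn)) // leq_pmull.
have sx p : sparse k (x p).
  elim: p => [|p IH]; last by have [] := pgot_contraction hkq kn d2 sxs IH (xstep p).
  by rewrite x0; apply: (@sparse_subset _ _ finset.set0) => [|i _]; rewrite ?cards0 // mxE.
have rec p : l2norm (x p.+1 - xs) <= rho * l2norm (x p - xs) + tau * l2norm eta.
  have [_ step] := pgot_contraction hkq kn d2 sxs (sx p) (xstep p).
  by apply: pgot_rate; rewrite ?l2norm_ge0.
have tau0 : 0 <= tau * l2norm eta.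
  rewrite mulr_ge0 ?l2norm_ge0 // divr_ge0 ?mulr_ge0 ?sqrtr_ge0 //.
  have c2 := @ge2_ceil_ratio R _ _ hk hkq; have s2 := sqrt5_ge2 R.
  have [d0 _ _] := ric_smallest A (2 * k).
  by rewrite addr_ge0 // !mulr_ge0 //; lra.
have bound : forall p, l2norm (x p - xs)
    <= rho ^+ p * l2norm (x 0%N - xs) + tau * l2norm eta / (1 - rho).
  apply: (@affine_recurrence_bound _ (fun p => l2norm (x p - xs))) => //.
  by rewrite rho0 rho1.
split=> [p|eta0].
  (* The recurrence gives the power [p.+1] of [rho], weakened to [p] by [rho <= 1]. *)
  apply: le_trans (bound p.+1) _; rewrite mulrAC lerD2r ler_wpM2r ?l2norm_ge0 //.
  by rewrite exprS ler_piMl ?exprn_ge0 // ltW.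
apply/subr_cvg0/norm_cvg0P.
(* With [eta = 0] the sup norm of the error lies between 0 and a geometric sequence of ratio
   [rho < 1]. *)
apply: (squeeze_cvgr (f := fun=> 0)
  (h := fun p => rho ^+ p * l2norm (x 0%N - xs))).
- apply: nearW => p; rewrite normr_ge0 (le_trans (mx_norm_le_l2norm _)) //.
  by have := bound p; rewrite eta0 l2norm0 mulr0 mul0r addr0.
- exact: cvg_cst.
- rewrite -[X in _ --> X](mul0r (l2norm (x 0%N - xs))).
  by apply: cvgMr_tmp; apply: cvg_expr; rewrite ger0_norm.
Qed.
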